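(* Let $n\ge 3$ be an integer and let $\mathcal{P}_n(\mathcal{I}_{1,n-1})\subset\mathbb{R}^n$ be the first pyramidal interval vector polytope, i.e. the convex hull of $e_1,\dots,e_n$, $\alpha_{1,n-1}=e_1+e_2+\dots+e_{n-1}$ and $\alpha_{2,n}=e_2+e_3+\dots+e_n$. Then its $f$-vector satisfies, for all integers $-1\le k\le n$, $$f_k(\mathcal{P}_n(\mathcal{I}_{1,n-1}))=\binom{n-1}{k}+\binom{n+1}{k+1}.$$
   Context: Here $e_i$ denotes the $i$-th standard unit vector of $\mathbb{R}^n$. For an $n$-dimensional polytope $\mathcal{P}$, $f_k(\mathcal{P})$ is the number of $k$-dimensional faces of $\mathcal{P}$, with the convention $f_{-1}=f_n=1$ (the empty face and $\mathcal{P}$ itself), and the $f$-vector is $(f_{-1},f_0,f_1,\dots,f_n)$. Binomial coefficients $\binom{a}{b}$ with $b<0$ or $b>a$ are $0$. *)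

(* Defs.v *)
From HB Require Import structures.
From mathcomp Require Import all_boot all_order all_algebra.
From mathcomp Require Import mathcomp_extra boolp classical_sets functions.
From mathcomp Require Import cardinality reals convex.

Set Implicit Arguments.
Unset Strict Implicit.
Unset Printing Implicit Defensive.

Import Order.TTheory GRing.Theory Num.Theory.

Local Open Scope classical_set_scope.
Local Open Scope ring_scope.

Definition binz (a : nat) (b : int) : nat :=
  if b is Posz m then 'C(a, m) else 0%N.

Section Polytopes.
Context {R : realType} {n : nat}.
Implicit Types P F S : set 'rV[R]_n.

Definition dot (u v : 'rV[R]_n) : R := \sum_(i < n) u 0 i * v 0 i.

Definition conv_hull S : set 'rV[R]_n :=
  smallest (fun C : set (convex_lmodType 'rV[R]_n) => convex_set C) S.

Definition affine_hull S : set 'rV[R]_n :=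
  [set y | exists m (c : 'I_m -> R) (x : 'I_m -> 'rV[R]_n),
    [/\ forall i, S (x i), \sum_(i < m) c i = 1
      & y = \sum_(i < m) c i *: x i]].

(* The dimension is that of the direction space of the affine hull; the empty
   set has dimension -1. *)
Definition has_dim S (k : int) : Prop :=
  (S = set0 /\ k = -1) \/
  exists (p : 'rV[R]_n) (U : {vspace 'rV[R]_n}),
    affine_hull S = [set p + u | u in [set u | u \in U]] /\ k = (\dim U)%:Z.

(* The valid inequality may be degenerate (c = 0), so set0 and P itself are
   faces of P. *)
Definition is_face P F : Prop :=
  exists (c : 'rV[R]_n) (b : R),
    (forall x, P x -> dot c x <= b) /\ F = P `&` [set x | dot c x = b].

(* f_k(P) is the cardinality of this set. *)
Definition faces P (k : int) : set (set 'rV[R]_n) :=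
  [set F | is_face P F /\ has_dim F k].

End Polytopes.

(* e_i + ... + e_j for 1-based i and j, whereas 'I_n is 0-based. *)
Definition interval_vector (R : realType) (n i j : nat) : 'rV[R]_n :=
  \sum_(l < n | (i <= l.+1 <= j)%N) delta_mx 0 l.

Definition pyramidal_polytope (R : realType) (n : nat) : set 'rV[R]_n :=
  conv_hull (range (fun i : 'I_n => delta_mx 0 i : 'rV[R]_n)
             `|` [set interval_vector R n 1 n.-1; interval_vector R n 2 n]).

Arguments interval_vector R n i j : clear implicits.
Arguments pyramidal_polytope R n : clear implicits.

(* Main.v *)
(** Write a and b for the two interval vectors. Up to scaling, the only affine
    relation among the n + 2 generators is a + e_n = b + e_1, so the polytope is
    an iterated pyramid over the parallelogram with diagonals {a, e_n} and
    {b, e_1}. A set T of generators is the set of all generators on some face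
    iff T contains both diagonals or neither: an affine function has the same
    sum of values on the two diagonals, and this is the only constraint on its
    values at the generators. Such a T spans a face of dimension #|T| - 1, or
    #|T| - 2 when it contains the diagonals, and counting these T by
    inclusion-exclusion over the two diagonals gives the f-vector. *)

Require Import Defs.
From mathcomp Require Import all_boot all_order all_algebra.
From mathcomp Require Import boolp classical_sets cardinality reals.
From mathcomp Require Import unstable convex
  interval_inference.
From mathcomp Require Import ring lra zify.

Set Implicit Arguments.
Unset Strict Implicit.
Unset Printing Implicit Defensive.

Import Order.TTheory GRing.Theory Num.Theory.

Local Open Scope classical_set_scope.
Local Open Scope card_scope.
Local Open Scope ring_scope.

(** * Linear forms and convex combinations *)

Lemma dot_sumr (R : realType) (n : nat) (I : finType) (c : 'rV[R]_n)
    (l : I -> R) (x : I -> 'rV[R]_n) :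
  dot c (\sum_i l i *: x i) = \sum_i l i * dot c (x i).
Proof.
rewrite /dot; under eq_bigr => j _ do rewrite summxE mulr_sumr.
rewrite exchange_big /=; apply: eq_bigr => i _; rewrite mulr_sumr.
by apply: eq_bigr => j _; rewrite mxE mulrCA.
Qed.

(** Convexity is a statement about two points, so the sum is built up by induction on the list.
    Dividing by the total weight makes the induction hypothesis usable for the tail, whose weights
    need not sum to 1. *)
Lemma convex_set_sum (R : realType) (V : lmodType R)
    (C : set (convex_lmodType V)) (I : eqType) (s : seq I) (l : I -> R)
    (x : I -> V) :
  convex_set C -> (forall i, C (x i)) -> (forall i, 0 <= l i) ->
  0 < \sum_(i <- s) l i ->
  C ((\sum_(i <- s) l i)^-1 *: \sum_(i <- s) l i *: x i).
Proof.
move=> cC Cx l0; elim: s => [|i s IH]; first by rewrite big_nil ltxx.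
rewrite !big_cons; set a := \sum_(j <- s) l j; set y := \sum_(j <- s) l j *: _.
have a0 : 0 <= a by exact: sumr_ge0.
(* A tail of total weight 0 cannot be normalised, but then all its weights vanish and only [x i]
   remains. *)
have [az|anz] := eqVneq a 0.
  have -> : y = 0.
    rewrite /y big_seq big1// => j js; move/eqP: az; rewrite psumr_eq0//.
    by move/allP/(_ _ js)/eqP ->; rewrite scale0r.
  by rewrite az !addr0 => li0; rewrite scalerA mulVf ?gt_eqF// scale1r.
have {}a0 : 0 < a by rewrite lt_neqAle eq_sym anz.
move=> s0; have Cy := IH a0.
have t0 : 0 <= l i / (l i + a) by rewrite divr_ge0// ltW.
have t1 : l i / (l i + a) <= 1 by rewrite ler_pdivrMr// mul1r lerDl ltW.
have := @cC (x i) (a^-1 *: y) (Itv01 t0 t1) (mem_set (Cx i)) (mem_set Cy).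
move/set_mem; congr C.
rewrite /conv/= /onem scalerDr !scalerA.
congr (_ *: _ + _ *: _); first exact: mulrC.
by field; rewrite !gt_eqF.
Qed.

(** * Hulls, faces and dimension of a finite point configuration *)

Section Configuration.
Context {R : realType} {n : nat} {I : finType} (v : I -> 'rV[R]_n).
Implicit Types (T : {set I}) (l : I -> R).

(** Weights live on all of [I] and vanish off [T], so that combinations over different subsets can
    be compared and added without reindexing. *)
Definition vaff T : set 'rV[R]_n :=
  [set x | exists l, [/\ forall i, i \notin T -> l i = 0,
     \sum_i l i = 1 & x = \sum_i l i *: v i]].

Definition vhull T : set 'rV[R]_n :=
  [set x | exists l, [/\ forall i, 0 <= l i, forall i, i \notin T -> l i = 0,
     \sum_i l i = 1 & x = \sum_i l i *: v i]].

Lemma vhull_point T i : i \in T -> vhull T (v i).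
Proof.
move=> iT; exists (fun j => (j == i)%:R); split.
- by move=> j; case: (j == i).
- by move=> j; case: eqVneq => // ->; rewrite iT.
- by rewrite (bigD1 i)//= eqxx big1 ?addr0// => j /negbTE ->.
- rewrite (bigD1 i)//= eqxx scale1r big1 ?addr0// => j /negbTE ->.
  by rewrite scale0r.
Qed.

Lemma vhull0 : vhull finset.set0 = set0.
Proof.
rewrite -subset0 => x [l [_ l0 + _]].
rewrite (eq_bigr (fun=> 0)) => [|i _]; last by rewrite l0// inE.
by move/eqP; rewrite big1_eq eq_sym oner_eq0.
Qed.

Lemma conv_hull_range : conv_hull (range v) = vhull finset.setT.
Proof.
apply/seteqP; split => x.
  apply: smallest_sub; last first.
    by move=> _ [i _ <-]; apply: vhull_point; rewrite inE.
  move=> y z t /set_mem[l [l0 _ l1 ->]] /set_mem[m [m0 _ m1 ->]].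
  apply/mem_set; exists (fun i => t%:num * l i + t%:num.~ * m i); split.
  - by move=> i; rewrite addr_ge0 ?mulr_ge0 ?onem_ge0.
  - by move=> i; rewrite inE.
  - by rewrite big_split/= -!mulr_sumr l1 m1 !mulr1 add_onemK.
  - rewrite /conv/= !scaler_sumr -big_split/=; apply: eq_bigr => i _.
    by rewrite [RHS]scalerDl -!scalerA.
move=> [l [l0 _ l1 ->]] C [cC vC].
have := @convex_set_sum _ _ C _ (enum I) l v cC.
rewrite !big_enum/= l1 invr1 scale1r; apply => // i.
by apply: vC; exists i.
Qed.

(** A convex combination attains the bound only if the terms [l i * (b - dot c (v i))], all
    nonnegative, sum to 0; hence every point with nonzero weight attains it. *)
Lemma vhull_face T (c : 'rV[R]_n) (b : R) :
  (forall i, i \in T -> dot c (v i) <= b) ->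
  vhull T `&` [set x | dot c x = b]
  = vhull (T :&: [set i | dot c (v i) == b])%SET.
Proof.
move=> cb; apply/seteqP; split => x.
  move=> [[l [l0 lT l1 ->]]] /=; rewrite dot_sumr => lb.
  exists l; split=> // i; rewrite !inE negb_and.
  have [iT /=|/lT//] := boolP (i \in T) => iN.
  have : \sum_i l i * (b - dot c (v i)) == 0.
    under eq_bigr do rewrite mulrBr.
    by rewrite sumrB lb -mulr_suml l1 mul1r subrr.
  rewrite psumr_eq0 => [|j _]; last first.
    have [/cb jT|/lT ->] := boolP (j \in T); last by rewrite mul0r.
    by rewrite mulr_ge0// subr_ge0.
  move/allP/(_ i); rewrite mem_index_enum => /(_ isT)/=.
  by rewrite mulf_eq0 subr_eq0 (eq_sym b) (negbTE iN) orbF => /eqP.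
move=> [l [l0 lT l1 ->]]; split.
  by exists l; split=> // i iN; apply: lT; rewrite inE (negbTE iN).
rewrite /= dot_sumr -[RHS]mul1r -l1 mulr_suml; apply: eq_bigr => i _.
have [|/lT ->] := boolP (i \in (T :&: [set i | dot c (v i) == b])%SET).
  by rewrite !inE => /andP[_ /eqP ->].
by rewrite !mul0r.
Qed.

Lemma affine_hull_vhull T : affine_hull (vhull T) = vaff T.
Proof.
apply/seteqP; split => x.
  move=> [m [c [y [yT c1 ->]]]].
  have [l lP] := choice yT.
  exists (fun i => \sum_j c j * l j i); split.
  - move=> i iN; rewrite big1// => j _; have [_ -> //] := lP j.
    by rewrite mulr0.
  - rewrite exchange_big/= -c1; apply: eq_bigr => j _.
    by have [_ _ l1 _] := lP j; rewrite -mulr_sumr l1 mulr1.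
  - under [RHS]eq_bigr do rewrite scaler_suml.
    rewrite exchange_big/=; apply: eq_bigr => j _.
    have [_ _ _ ->] := lP j; rewrite scaler_sumr; apply: eq_bigr => i _.
    by rewrite scalerA.
move=> [l [lT l1 ->]].
exists #|T|, (fun j => l (enum_val j)), (fun j => v (enum_val j)).
split.
- by move=> j; apply: vhull_point; exact: enum_valP.
- rewrite -(big_enum_val l) -l1 [RHS](bigID (mem T))/=.
  by rewrite [X in _ + X]big1 ?addr0.
- rewrite (bigID (mem T))/= [X in _ + X]big1 ?addr0 => [|i /lT ->]; last first.
    by rewrite scale0r.
  exact: (big_enum_val (fun i => l i *: v i)).
Qed.

Definition affinely_independent T := forall l,
  (forall i, i \notin T -> l i = 0) -> \sum_i l i = 0 ->
  \sum_i l i *: v i = 0 -> forall i, l i = 0.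

(** The differences [v i - v i0], for [i] in [T] other than a base point [i0], form a basis of the
    direction space. [S] is kept apart from [T] so that [T] may be a proper subset of the generators
    that span [S]. *)
Lemma has_dim_vaff (S : set 'rV[R]_n) T :
  affine_hull S = vaff T -> T != finset.set0 -> affinely_independent T ->
  has_dim S (#|T|%:Z - 1).
Proof.
move=> ST /set0Pn[i0 i0T] indT; right.
pose D := (T :\ i0)%SET.
have cT : #|T| = #|D|.+1 by rewrite (cardsD1 i0) i0T.
pose M : 'M[R]_(#|D|, n) := \matrix_j (v (enum_val j) - v i0).
have ME (c : 'rV[R]_#|D|) (l : I -> R) :
    (forall j, l (enum_val j) = c 0 j) ->
    c *m M = \sum_(i in D) l i *: (v i - v i0).
  move=> lc; rewrite mulmx_sum_row.
  rewrite (big_enum_val (fun i => l i *: (v i - v i0)))/=.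
  by apply: eq_bigr => j _; rewrite lc rowK.
have lE (c : 'rV[R]_#|D|) : exists l : I -> R,
    (forall j, l (enum_val j) = c 0 j) /\ (forall i, i \notin D -> l i = 0).
  exists (fun i => \sum_(j | enum_val j == i) c 0 j); split.
    move=> j; rewrite (eq_bigl (pred1 j)) ?big_pred1_eq// => k.
    by rewrite /= (inj_eq enum_val_inj).
  move=> i iN; rewrite big1// => j /eqP ji; move: iN.
  by rewrite -ji enum_valP.
have ker0 : lker (linfun (mulmxr M : 'rV[R]__ -> 'rV[R]_n)) == 0%VS.
  rewrite -subv0; apply/subvP => c; rewrite memv_ker memv0 lfunE/= => /eqP cM.
  have [l [lc l0]] := lE c.
  (* A linear relation among the differences becomes an affine relation among the points once [i0]
     gets the weight that makes the total 0. *)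
  pose m i := if i == i0 then - \sum_(i in D) l i else l i.
  have mi0 : m i0 = - \sum_(i in D) l i by rewrite /m eqxx.
  have mD : \sum_(i in D) m i = \sum_(i in D) l i.
    by apply: eq_bigr => i; rewrite !inE /m => /andP[/negbTE ->].
  have m0 : forall i, m i = 0.
    apply: indT.
    - move=> i iN; rewrite /m; case: eqVneq => [ii0|_].
        by rewrite ii0 i0T in iN.
      by apply: l0; rewrite !inE (negbTE iN) andbF.
    - rewrite (bigD1 i0)//= (bigID (mem T))/= mi0.
      rewrite [X in _ + (_ + X)]big1 ?addr0; last first.
        move=> i /andP[ii0 iN]; rewrite /m (negbTE ii0); apply: l0.
        by rewrite !inE (negbTE iN) andbF.
      rewrite (eq_bigl (fun i => i \in D)) => [|i]; last by rewrite !inE.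
      by rewrite mD addNr.
    - rewrite (bigD1 i0)//= (bigID (mem T))/= mi0.
      rewrite [X in _ + (_ + X)]big1 ?addr0; last first.
        move=> i /andP[ii0 iN]; rewrite /m (negbTE ii0) l0 ?scale0r//.
        by rewrite !inE (negbTE iN) andbF.
      rewrite (eq_bigl (fun i => i \in D)) => [|i]; last by rewrite !inE.
      move: cM; rewrite (ME _ _ lc).
      under [X in X = 0 -> _]eq_bigr do rewrite scalerBr.
      rewrite sumrB -scaler_suml => cM.
      rewrite (eq_bigr (fun i => l i *: v i)); last first.
        by move=> i; rewrite !inE /m => /andP[/negbTE ->].
      by rewrite scaleNr addrC.
  apply/eqP/rowP => j; rewrite mxE -lc -(m0 (enum_val j)) /m.
  by have := enum_valP j; rewrite !inE => /andP[/negbTE ->].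
exists (v i0), (limg (linfun (mulmxr M : 'rV[R]__ -> 'rV[R]_n))).
split; last first.
  rewrite limg_dim_eq ?(eqP ker0) ?capv0// dimvf /dim/= mul1n cT.
  by rewrite -[in LHS]addn1 PoszD addrK.
rewrite ST; apply/seteqP; split => x.
  move=> [l [lT l1 ->]].
  exists (\sum_i l i *: v i - v i0); last by rewrite addrC subrK.
  apply/memv_imgP; exists (\row_j l (enum_val j)); rewrite ?memvf// lfunE/=.
  rewrite (ME _ l) => [|j]; last by rewrite mxE.
  rewrite -{1}(scale1r (v i0)) -l1 scaler_suml -sumrB.
  rewrite (bigID (mem D))/= [X in _ + X]big1 ?addr0 => [|i].
    by apply: eq_bigr => i _; rewrite scalerBr.
  rewrite !inE negb_and negbK => /orP[/eqP ->|/lT ->]; first by rewrite subrr.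
  by rewrite !scale0r subrr.
move=> [_ /memv_imgP[c _ ->]] <-; rewrite lfunE/=.
have [l [lc l0]] := lE c; rewrite (ME _ _ lc).
(* Since [l] vanishes at [i0], the base point takes up whatever weight is missing from 1. *)
exists (fun i => l i + (i == i0)%:R * (1 - \sum_i l i)); split.
- move=> i iN; rewrite l0 ?inE ?(negbTE iN) ?andbF// add0r.
  by case: eqVneq => [ii0|_]; rewrite ?mul0r//; rewrite ii0 i0T in iN.
- rewrite big_split/= -mulr_suml.
  rewrite (bigD1 i0 (P := xpredT) (F := fun i => (i == i0)%:R))//=.
  rewrite eqxx [X in (_ + X) * _]big1 ?addr0 => [|i /negbTE ->//].
  by rewrite mul1r addrC subrK.
- under [RHS]eq_bigr do rewrite scalerDl.
  rewrite big_split/=.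
  rewrite (bigD1 i0 (P := xpredT) (F := fun i => (_ * _) *: v i))//=.
  rewrite eqxx mul1r [X in _ + (_ + X)]big1 ?addr0; last first.
    by move=> i /negbTE ->; rewrite mul0r scale0r.
  have -> : \sum_(i in D) l i *: (v i - v i0) = \sum_i l i *: (v i - v i0).
    rewrite [RHS](bigID (mem D))/= [X in _ + X]big1 ?addr0// => i /l0 ->.
    by rewrite scale0r.
  under [X in _ + X = _]eq_bigr do rewrite scalerBr.
  rewrite sumrB -scaler_suml scalerBl scale1r.
  by rewrite addrCA.
Qed.

End Configuration.

(** The direction space is determined by the affine hull: it consists of the differences of its
    points. The affine hull of the empty set is empty, hence no translate of a subspace. *)
Lemma has_dim_inj (R : realType) (n : nat) (S : set 'rV[R]_n) (k k' : int) :
  has_dim S k -> has_dim S k' -> k = k'.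
Proof.
have aff0 : affine_hull (set0 : set 'rV[R]_n) = set0.
  rewrite -subset0 => x [[|m] [c [y [y0 c1 _]]]]; last exact: (y0 ord0).
  by move/eqP: c1; rewrite big_ord0 eq_sym oner_eq0.
have mix p (U : {vspace 'rV[R]_n}) :
    affine_hull set0 <> [set p + u | u in [set u | u \in U]].
  rewrite aff0 => E; have : set0 p.
    by rewrite E; exists 0; rewrite ?addr0//= mem0v.
  by [].
move=> [[S0 ->]|[p [U [E ->]]]] [[S0' ->]|[q [W [E' ->]]]] //.
- by move: E'; rewrite S0 => /mix.
- by move: E; rewrite S0' => /mix.
have sub p1 q1 (U1 W1 : {vspace 'rV[R]_n}) :
    [set p1 + u | u in [set u | u \in U1]] =
    [set q1 + u | u in [set u | u \in W1]] -> (U1 <= W1)%VS.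
  move=> EE; apply/subvP => u uU.
  have [w wW ewu] : [set q1 + u | u in [set u | u \in W1]] (p1 + u).
    by rewrite -EE; exists u.
  have [w0 wW0 ewp] : [set q1 + u | u in [set u | u \in W1]] p1.
    by rewrite -EE; exists 0; rewrite ?addr0//= mem0v.
  have -> : u = w - w0.
    apply: (@addrI _ p1); rewrite -ewu -ewp.
    by rewrite -addrA [w0 + _]addrC subrK.
  exact: rpredB.
have EW := etrans (esym E) E'.
congr (\dim _)%:Z; apply/subv_anti/andP; split.
  exact: sub EW.
exact: sub (esym EW).
Qed.

(** * Counting subsets relative to two disjoint pairs *)

(** Complements turn supersets of [A] into subsets of its complement. The lower index [#|I| - j]
    gives 0 when [j < #|A|], where the truncated difference [j - #|A|] would give 1. *)
Lemma card_supersets (I : finType) (A : {set I}) (j : nat) : (j <= #|I|)%N ->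
  #|[set T : {set I} | A \subset T & #|T| == j]%SET|
  = 'C(#|I| - #|A|, #|I| - j).
Proof.
move=> jI; have -> : (#|I| - #|A|)%N = #|(~: A)%SET|.
  by rewrite [RHS]cardsCs finset.setCK.
rewrite -cards_draws -(card_imset _ (@finset.setC_inj I)); apply: eq_card => T.
rewrite inE; apply/imsetP/andP => [[S]|[TA /eqP Tj]].
  rewrite inE => /andP[AS /eqP Sj] ->; rewrite finset.setCS; split=> //.
  by rewrite cardsCs finset.setCK Sj.
exists (~: T)%SET; rewrite ?finset.setCK// inE -finset.setCS finset.setCK TA/=.
by rewrite cardsCs finset.setCK Tj subKn.
Qed.

Definition balanced (I : finType) (A B T : {set I}) :=
  (A \subset T) == (B \subset T).

(** The sets counted have [j] elements and contain neither pair, or [j.+1] elements and contain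
    both. Inclusion-exclusion evaluates the first kind, and Pascal's rule brings the total to two
    binomials. *)
Lemma card_balanced (I : finType) (A B : {set I}) (j : nat) :
  #|A| = 2%N -> #|B| = 2%N -> (A :&: B)%SET = finset.set0 -> (j < #|I|)%N ->
  (#|[set T | balanced A B T & #|T| == j + (A \subset T)]%SET|
   = (if j is j'.+1 then 'C(#|I| - 3, j') else 0) + 'C(#|I| - 1, j))%N.
Proof.
move=> A2 B2 AB jI.
have AB4 : #|(A :|: B)%SET| = 4%N by rewrite cardsU AB cards0 A2 B2.
pose X k (E : {set I}) := [set T : {set I} | E \subset T & #|T| == k]%SET.
have cX k E : (k <= #|I|)%N -> #|X k E| = 'C(#|I| - #|E|, #|I| - k).
  exact: card_supersets.
set G := [set T | _ & _]%SET.
have I4 : (4 <= #|I|)%N by rewrite -AB4 max_card.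
have GE : G = (X j finset.set0 :\: (X j A :|: X j B) :|: X j.+1 (A :|: B))%SET.
  apply/setP => T; rewrite !inE finset.subUset finset.sub0set /balanced.
  by case: (A \subset T); case: (B \subset T);
    rewrite /= ?addn1 ?addn0 ?orbF ?andbT ?andbF ?orbb//=; case: (#|T| == j).
have dj : ((X j finset.set0 :\: (X j A :|: X j B)) :&: X j.+1 (A :|: B))%SET
    = finset.set0.
  apply/setP => T; rewrite !inE.
  by case: (#|T| =P j) => [->|]; rewrite ?andbF//= (ltn_eqF (ltnSn j)) !andbF.
have XAB : (X j A :&: X j B = X j (A :|: B))%SET.
  apply/setP => T; rewrite !inE finset.subUset.
  by case: (#|T| == j); rewrite ?andbT ?andbF.
have sub : (X j A :|: X j B \subset X j finset.set0)%SET.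
  apply/fintype.subsetP => T; rewrite !inE finset.sub0set.
  by case: (#|T| == j); rewrite ?andbT ?andbF.
have c1 : (#|G| = #|X j finset.set0 :\: (X j A :|: X j B)|
                  + #|X j.+1 (A :|: B)|)%N.
  by rewrite GE cardsU dj cards0 subn0.
have c2 := cardsID (X j A :|: X j B)%SET (X j finset.set0).
rewrite (finset.setIidPr sub) in c2.
have c3 := cardsUI (X j A) (X j B).
rewrite XAB in c3.
have jI' := ltnW jI.
rewrite (cX _ finset.set0 jI') cards0 subn0 in c2.
rewrite (cX _ A jI') (cX _ B jI') (cX _ _ jI') A2 B2 AB4 in c3.
rewrite (cX _ _ jI) AB4 in c1.
move: c1 c2 c3 jI I4; move: #|G| #|(_ :\: _)%SET| #|(_ :|: _)%SET| #|I|; clear.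
move=> a b c N + + + jN N4.
have [M NM] : exists M, N = M.+4 by exists (N - 4)%N; lia.
rewrite {N}NM in jN N4 *.
have -> : (M.+4 - 3 = M.+1)%N by lia.
have -> : (M.+4 - 1 = M.+3)%N by lia.
have -> : (M.+4 - 2 = M.+2)%N by lia.
have -> : (M.+4 - 4 = M)%N by lia.
(* All binomials are rewritten with lower index [r] or nearby, free of subtraction, so that repeated
   use of Pascal's rule reduces them to upper index [M]. *)
have [r rE] : exists r, (j + r = M.+3)%N by exists (M.+3 - j)%N; lia.
have -> : (M.+4 - j = r.+1)%N by lia.
have -> : (M.+4 - j.+1 = r)%N by lia.
have -> : 'C(M.+3, j) = 'C(M.+3, r).
  by rewrite -(@bin_sub M.+3 j) -?rE ?leq_addr// addKn.
have -> : (if j is j'.+1 then 'C(M.+1, j') else 0)%N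
          = (if r is r'.+1 then 'C(M.+1, r') else 0)%N.
  case: j rE {jN} => [|j]; case: r => [|r] // rE.
  - by rewrite bin_small//; lia.
  - by rewrite bin_small//; lia.
  - rewrite -(@bin_sub M.+1 j); last lia.
    by congr 'C(_, _); lia.
case: r rE => [|[|[|r]]] _; rewrite ?binS ?bin0 ?bin1 ?bin0n; lia.
Qed.

(** * The generators and the two diagonals *)

Section Pyramid.
Context {R : realType} {p : nat} (p_gt1 : (1 < p)%N).
Let I := ('I_p.+1 + bool)%type.
Implicit Types (T : {set I}) (e : bool).

(** The one coordinate at which the interval vector [inr e] is 0; the unit vector there is the other
    end of its diagonal. *)
Definition far e : 'I_p.+1 := if e then ord0 else ord_max.

(* inr false is alpha_{1,n-1} and inr true is alpha_{2,n}, where n = p + 1. *)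
Definition vertex (i : I) : 'rV[R]_p.+1 :=
  match i with
  | inl l => delta_mx 0 l
  | inr e => const_mx 1 - delta_mx 0 (far e)
  end.

Definition diagonal e : {set I} := [set inr e; inl (far e)]%SET.

Lemma pyramidal_polytopeE :
  pyramidal_polytope R p.+1 = vhull vertex finset.setT.
Proof.
rewrite -conv_hull_range; congr conv_hull.
have ivE i j : interval_vector R p.+1 i j = \row_l ((i <= l.+1 <= j)%N)%:R.
  apply/rowP => l; rewrite !mxE summxE.
  have [lij|lij] := boolP (_ && _).
    rewrite (bigD1 l)//= mxE !eqxx big1 ?addr0// => k /andP[_ kl].
    by rewrite mxE eqxx eq_sym (negbTE kl).
  rewrite big1// => k kij; rewrite mxE eqxx; case: eqVneq => // lk.
  by rewrite lk kij in lij.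
have a1 : interval_vector R p.+1 1 p = vertex (inr false).
  apply/rowP => l; rewrite ivE !mxE/= -val_eqE/=.
  case: (eqVneq (l : nat) p) => [->|lp]; first by rewrite ltnn subrr.
  by rewrite ltn_neqAle lp -ltnS ltn_ord subr0.
have a2 : interval_vector R p.+1 2 p.+1 = vertex (inr true).
  apply/rowP => l; rewrite ivE !mxE/= -val_eqE/= ltn_ord andbT ltnS lt0n.
  by case: (_ == _); rewrite ?subrr ?subr0.
rewrite /= a1 a2; apply/seteqP; split => x.
  case=> [[l _ <-]|[->|->]]; first by exists (inl l).
    by exists (inr false).
  by exists (inr true).
by move=> [[l|[]] _ <-]; [left; exists l|right; right|right; left].
Qed.

Lemma dot_vertexl (c : 'rV[R]_p.+1) l : dot c (vertex (inl l)) = c 0 l.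
Proof.
rewrite /dot (bigD1 l)//= mxE !eqxx mulr1 big1 ?addr0// => i /negbTE il.
by rewrite mxE il andbF mulr0.
Qed.

Lemma dot_vertexr (c : 'rV[R]_p.+1) e :
  dot c (vertex (inr e)) = \sum_i c 0 i - c 0 (far e).
Proof.
rewrite -[c 0 (far e)]dot_vertexl /dot -sumrB; apply: eq_bigr => i _.
by rewrite 2!mxE mulrDr mxE mulr1 mulrN.
Qed.

(** * Faces correspond to balanced sets of generators *)

(** On either diagonal the two values of the form add up to the sum of the entries of [c]. Both are
    at most [b], so both equal [b] exactly when this sum is [b + b], a condition that does not
    depend on the diagonal. *)
Lemma balanced_of_face (c : 'rV[R]_p.+1) (b : R) :
  (forall i, dot c (vertex i) <= b) ->
  balanced (diagonal false) (diagonal true) [set i | dot c (vertex i) == b]%SET.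
Proof.
move=> cb.
suff H e : (diagonal e \subset [set i | dot c (vertex i) == b]%SET)
           = (\sum_i c 0 i == b + b).
  by rewrite /balanced !H.
have := cb (inr e); have := cb (inl (far e)).
rewrite finset.subUset !finset.sub1set !inE dot_vertexr dot_vertexl => c1 c2.
apply/andP/eqP => [[/eqP h1 /eqP h2]|h]; first by lra.
by split; apply/eqP; lra.
Qed.

(** The slacks at all generators are prescribed first. Those at the unit vectors determine [c] in
    terms of [b], and equal sums on the diagonals allow one choice of [b] to fit both interval
    vectors. *)
Lemma face_of_balanced T : balanced (diagonal false) (diagonal true) T ->
  exists (c : 'rV[R]_p.+1) (b : R), (forall i, dot c (vertex i) <= b) /\
    T = [set i | dot c (vertex i) == b]%SET.
Proof.
move=> bT.
(* [opp] exchanges the two ends of each diagonal and fixes the other generators. *)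
pose opp (i : I) : I := match i with
  | inr e => inl (far e)
  | inl l => if l == ord0 then inr true else
             if l == ord_max then inr false else inl l
  end.
have oppfar e : opp (inl (far e)) = inr e.
  by case: e; rewrite /= ?eqxx// -val_eqE/= gtn_eqF// ltnW.
(* The slacks of the inequality to be built: nonnegative, zero exactly on T,
   with the same sum w on both diagonals. *)
pose h (i : I) : R := if i \in T then 0 else if opp i \in T then 2 else 1.
have hT i : (h i == 0) = (i \in T).
  rewrite /h; case: (i \in T); rewrite ?eqxx//.
  by case: ifP => _; apply/eqP; lra.
have h0 i : 0 <= h i by rewrite /h; do 2?case: ifP => _.
(* A diagonal not contained in [T] has slacks 0 and 2 if one end is in [T], and 1 and 1 if none
   is. *)
pose w : R := if diagonal true \subset T then 0 else 2.
have hw e : h (inr e) + h (inl (far e)) = w.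
  have -> : w = if diagonal e \subset T then 0 else 2.
    by case: e => //; rewrite /w -(eqP bT).
  rewrite finset.subUset !finset.sub1set /h oppfar /=.
  by case: (inr e \in T); case: (inl (far e) \in T); rewrite /=; lra.
pose s := \sum_l h (inl l).
(* This b makes the form c take the values b - h at inr false and inr true. *)
pose b := (s - w) / (p%:R - 1).
(* The equation [p.+1%:R * b - s = b + b - w] can be solved for [b] because [p] is not 1. *)
have p1 : p%:R - 1 != 0 :> R by rewrite subr_eq0 pnatr_eq1; lia.
pose c : 'rV[R]_p.+1 := \row_l (b - h (inl l)).
have sc : \sum_i c 0 i = b + b - w.
  under eq_bigr do rewrite mxE.
  rewrite sumrB sumr_const card_ord -/s -mulr_natr -natr1.
  have -> : s = b * (p%:R - 1) + w by rewrite /b divfK// subrK.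
  by ring.
have cE i : dot c (vertex i) = b - h i.
  case: i => [l|e]; first by rewrite dot_vertexl mxE.
  by rewrite dot_vertexr sc mxE -(hw e); ring.
exists c, b; split=> [i|]; first by rewrite cE gerBl.
apply/setP => i; rewrite inE cE -hT -[RHS]subr_eq0.
by rewrite addrAC subrr add0r oppr_eq0.
Qed.

(** * Affine relations among the generators, and dimensions of faces *)

(** The coordinates of the vector relation express all weights through those of the two interval
    vectors, [a] and [b]. Total weight 0 then reads [(a + b) * (1 - p%:R) = 0], and [p] is not 1. *)
Lemma affine_relation (l : I -> R) :
  \sum_i l i = 0 -> \sum_i l i *: vertex i = 0 ->
  l (inr true) = - l (inr false) /\
  forall j, l (inl j) = l (inr false) * (j == ord_max)%:R
                        + l (inr true) * (j == ord0)%:R.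
Proof.
rewrite !big_sumType/= !big_bool/= => l0 /rowP lv.
set a := l (inr false) in l0 lv *; set b := l (inr true) in l0 lv *.
have lE j : l (inl j) = a * (j == ord_max)%:R + b * (j == ord0)%:R - (a + b).
  have := lv j; rewrite !mxE summxE (bigD1 j)//= big1 ?addr0; last first.
    by move=> i /negbTE ij; rewrite !mxE eq_sym ij andbF mulr0.
  by rewrite !mxE !eqxx/=; move: (_ == _)%:R (_ == _)%:R => x y; lra.
have sl : \sum_j l (inl j) = (a + b) * (1 - p.+1%:R).
  under eq_bigr do rewrite lE.
  rewrite sumrB big_split/= -!mulr_sumr sumr_const card_ord.
  rewrite -[(_ + _) *+ _]mulr_natr.
  rewrite (bigD1 ord_max)//= eqxx big1 ?addr0 => [|i /negbTE ->//].
  rewrite (bigD1 ord0)//= big1 ?addr0 => [|i /negbTE ->//].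
  by ring.
have ab : a + b = 0.
  have : (a + b) * (1 - p%:R) == 0.
    by apply/eqP; rewrite -l0 sl -natr1; ring.
  by rewrite mulf_eq0 subr_eq0 (eq_sym 1) pnatr_eq1 => /orP[/eqP //|]; lia.
by split=> [|j]; [lra|rewrite lE ab subr0].
Qed.

(** A nonzero relation has nonzero weight at all four ends of the diagonals, so one end missing from
    [T] excludes it. *)
Lemma vertex_independent T e : ~~ (diagonal e \subset T) ->
  affinely_independent vertex T.
Proof.
move=> eT l lT l0 lv; have [ba lE] := affine_relation l0 lv.
have far_neq : (ord0 : 'I_p.+1) != ord_max by rewrite -val_eqE/=; lia.
have far_neq' : (ord_max : 'I_p.+1) != ord0 by rewrite eq_sym.
have a0 : l (inr false) = 0.
  move: eT; rewrite finset.subUset !finset.sub1set negb_and.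
  case/orP => /lT; first by case: e => // /eqP; rewrite ba oppr_eq0 => /eqP.
  rewrite lE; case: e; rewrite /= ?eqxx.
    rewrite (negbTE far_neq) mulr0 add0r mulr1 ba.
    by move/eqP; rewrite oppr_eq0 => /eqP.
  by rewrite (negbTE far_neq') mulr0 addr0 mulr1.
by case=> [j|[]]; rewrite ?lE ?ba a0 ?oppr0 ?mul0r ?addr0.
Qed.

(** The affine relation is supported on [T], and a multiple of it shifts the weight of [inr true]
    onto the other three ends. *)
Lemma vaff_diagonals T :
  diagonal false \subset T -> diagonal true \subset T ->
  vaff vertex T = vaff vertex (T :\ inr true)%SET.
Proof.
rewrite !finset.subUset !finset.sub1set => /andP[aT nT] /andP[bT oT].
apply/seteqP; split => x [l [lT l1 ->]]; last first.
  by exists l; split=> // i iN; apply: lT; rewrite !inE (negbTE iN) andbF.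
pose b := l (inr true).
(* The coefficients of a + e_n - b - e_1. *)
pose r (i : I) : R := match i with
  | inl j => (j == ord_max)%:R - (j == ord0)%:R
  | inr e => (~~ e)%:R - e%:R
  end.
have rs : \sum_i r i = 0.
  rewrite big_sumType big_bool/= sumrB (bigD1 ord_max)//= eqxx.
  rewrite big1 ?addr0 => [|i /negbTE ->//].
  rewrite (bigD1 ord0)//= big1 ?addr0 => [|i /negbTE ->//].
  by ring.
have rv : \sum_i r i *: vertex i = 0.
  rewrite big_sumType big_bool/= subr0 sub0r scaleN1r scale1r.
  under eq_bigr do rewrite scalerBl.
  rewrite sumrB (bigD1 ord_max)//= eqxx scale1r.
  rewrite big1 ?addr0 => [|i /negbTE ->]; last by rewrite scale0r.
  rewrite (bigD1 ord0)//= scale1r.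
  rewrite big1 ?addr0 => [|i /negbTE ->]; last by rewrite scale0r.
  by apply/rowP => j; rewrite !mxE; ring.
exists (fun i => l i + b * r i); split.
- move=> i; rewrite !inE negb_and negbK => /orP[/eqP ->|iN].
    by rewrite /b/= sub0r mulrN1 subrr.
  rewrite lT// add0r.
  case: i iN => [j|[]] jN; rewrite ?bT ?aT// in jN *.
  rewrite /r; case: eqVneq => [jm|_]; first by rewrite jm nT in jN.
  case: eqVneq => [j0|_]; first by rewrite j0 oT in jN.
  by rewrite subrr mulr0.
- by rewrite big_split/= -mulr_sumr rs mulr0 addr0.
- under [RHS]eq_bigr do rewrite scalerDl -scalerA.
  by rewrite big_split/= -scaler_sumr rv scaler0 addr0.
Qed.

Lemma has_dim_vhull T : balanced (diagonal false) (diagonal true) T ->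
  has_dim (vhull vertex T) (#|T|%:Z - 1 - (diagonal false \subset T)%:Z).
Proof.
rewrite /balanced => /eqP bT.
have [->|T0] := eqVneq T finset.set0.
  left; rewrite vhull0 cards0; split=> //.
  by rewrite finset.subUset !finset.sub1set !inE.
case: (boolP (diagonal false \subset T)) bT => fT /esym/idP.
  move=> tT; have bmem : inr true \in T.
    by move: tT; rewrite finset.subUset !finset.sub1set => /andP[].
  have -> : #|T|%:Z - 1 - 1 = #|(T :\ inr true)%SET|%:Z - 1.
    by rewrite (cardsD1 (inr true) T) bmem PoszD [X in X - 1 - 1]addrC addrK.
  apply: has_dim_vaff; first by rewrite affine_hull_vhull vaff_diagonals.
    apply/set0Pn; exists (inr false); rewrite !inE/=.
    by move: fT; rewrite finset.subUset !finset.sub1set => /andP[].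
  (* What remains lacks an end of the diagonal [true], hence is independent. *)
  apply: (@vertex_independent _ true).
  by rewrite finset.subUset !finset.sub1set !inE eqxx.
move=> _; rewrite subr0; apply: has_dim_vaff => //.
  exact: affine_hull_vhull.
exact: vertex_independent fT.
Qed.

(** * Enumeration of the faces *)

(** A balanced [T] consists of all generators attaining some valid inequality, so it is recovered
    from its hull as the set of generators lying there. *)
Lemma vhull_balanced_inj :
  {in [set T | balanced (diagonal false) (diagonal true) T] &,
    injective (vhull vertex)}.
Proof.
have H T : balanced (diagonal false) (diagonal true) T ->
    forall i, (i \in T) = `[< vhull vertex T (vertex i) >].
  move=> /face_of_balanced[c [b [cb ->]]] i; rewrite inE.
  have := @vhull_face _ _ _ vertex finset.setT c b (fun i _ => cb i).
  rewrite finset.setTI => <-; apply/eqP/asboolP => [dcb|[]//].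
  by split=> //; apply: vhull_point; rewrite inE.
move=> T S /set_mem bT /set_mem bS TS; apply/setP => i.
by rewrite (H _ bT) (H _ bS) TS.
Qed.

Lemma is_faceE (F : set 'rV[R]_p.+1) :
  is_face (pyramidal_polytope R p.+1) F <->
  exists2 T, balanced (diagonal false) (diagonal true) T & F = vhull vertex T.
Proof.
rewrite pyramidal_polytopeE; split=> [[c [b [Pcb ->]]]|[T bT ->]].
  have cb i : dot c (vertex i) <= b by apply/Pcb/vhull_point; rewrite inE.
  exists [set i | dot c (vertex i) == b]%SET; first exact: balanced_of_face.
  by rewrite vhull_face// finset.setTI.
have [c [b [cb ->]]] := face_of_balanced bT; exists c, b; split.
  move=> _ [l [l0 _ l1 ->]]; rewrite dot_sumr -[leRHS]mul1r -l1 mulr_suml.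
  by apply: ler_sum => i _; rewrite ler_wpM2l.
by rewrite vhull_face// finset.setTI.
Qed.

(** The dimension is shifted by one so that [j = 0] is the empty face; there the first binomial
    would have lower index -1, whence the case distinction. *)
Lemma card_faces (j : nat) : (j < p.+3)%N ->
  faces (pyramidal_polytope R p.+1) (j%:Z - 1)
    #= `I_((if j is j'.+1 then 'C(p, j') else 0) + 'C(p.+2, j))%N.
Proof.
move=> jp.
set G := [set T | balanced (diagonal false) (diagonal true) T
                & #|T| == (j + (diagonal false \subset T))%N]%SET.
have -> : faces (pyramidal_polytope R p.+1) (j%:Z - 1)
          = vhull vertex @` [set` G].
  apply/seteqP; split => [F [/is_faceE[T bT ->]]|_ [T + <-]].
    move/(has_dim_inj (has_dim_vhull bT)) => Tj; exists T => //=.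
    rewrite inE bT/=; apply/eqP.
    by move: Tj; move: (nat_of_bool _) #|_| => d t; lia.
  rewrite /= inE => /andP[bT /eqP Tj]; split; first by apply/is_faceE; exists T.
  by move: (has_dim_vhull bT); rewrite Tj PoszD addrAC addrK.
apply: (card_eq_trans (inj_card_eq _)).
  move=> T S /set_mem/= + /set_mem/=; rewrite !inE => /andP[bT _] /andP[bS _].
  by apply: vhull_balanced_inj; apply/mem_set.
have cI : #|{: I}| = p.+3 by rewrite card_sum card_ord card_bool addn2.
have -> : ((if j is j'.+1 then 'C(p, j') else 0) + 'C(p.+2, j))%N = #|G|.
  rewrite card_balanced ?cI ?subSS ?subn0//.
  - by rewrite cards2.
  - by rewrite cards2.
  - apply/setP => -[l|[]]; rewrite !inE/=.
    + by rewrite !(inj_eq inl_inj) -!val_eqE/=; apply/negbTE; lia.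
    + by [].
    + by [].
have -> : [set` G] = (fun i => enum_val i) @` [set: 'I_#|G|].
  apply/seteqP; split=> [T TG|_ [i _ <-]]; last exact: enum_valP.
  by exists (enum_rank_in TG T); rewrite ?enum_rankK_in.
apply: card_eq_trans (inj_card_eq _) (card_esym card_II).
by move=> i k _ _; exact: enum_val_inj.
Qed.

End Pyramid.

Theorem theorem4 (R : realType) (n : nat) (hn : (3 <= n)%N)
    (k : int) (hk : -1 <= k <= n%:Z) :
  faces (pyramidal_polytope R n) k
    #= `I_(binz n.-1 k + binz n.+1 (k + 1))%N.
Proof.
case: n hn hk => [//|p] p_gt1 /andP[k_ge k_le].
have [j kE] : exists j : nat, k = j%:Z - 1.
  by exists `|(k + 1)%R|%N; rewrite gez0_abs; lia.
have := @card_faces R p p_gt1 j; rewrite -kE => /(_ ltac:(lia)).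
rewrite {}kE in k_ge k_le *; rewrite subrK /=.
by case: j k_le k_ge => [|j] //; rewrite -addn1 PoszD addrK.
Qed.
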